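(* Let $f:\mathbb{R}^d\to\mathbb{R}$ be differentiable, $\mu$-strongly convex ($\mu>0$) and $L$-smooth ($L>0$), with minimizer $x^*$ and $f^*=f(x^* )$. Let $0\le\rho\le\frac1L$ and $x^0\in\mathbb{R}^d$, and let $(x^t)_{t\ge 0}$ be generated by deterministic USAM with constant radius $\rho_t=\rho$ and the Polyak scheduler, i.e. for $t\ge 0$ $$e^t=x^t+\rho\nabla f(x^t),\qquad \gamma_t=\frac{f(e^t)-f^*-\rho\langle\nabla f(e^t),\nabla f(x^t)\rangle}{\|\nabla f(e^t)\|^2},\qquad x^{t+1}=x^t-\gamma_t\nabla f(e^t).$$ Then for all $t\ge 0$, $$\|x^t-x^*\|^2\le\left(1-\frac{\mu(1-L\rho)^2}{4L}\right)^t\|x^0-x^*\|^2.$$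
   Context: $\|\cdot\|$ is the Euclidean norm. $f$ is $L$-smooth if $\|\nabla f(x)-\nabla f(y)\|\le L\|x-y\|$ for all $x,y$; $f$ is $\mu$-strongly convex if $x\mapsto f(x)-\frac{\mu}{2}\|x\|^2$ is convex. Convention: if $\nabla f(x^t)=0$ then $x^t$ is a minimizer, the algorithm terminates, and we set $x^{s}=x^t$ for all $s\ge t$. *)

(* Defs.v *)
From mathcomp Require Import all_boot all_order all_algebra.
From mathcomp Require Import all_classical all_reals all_analysis.
Import Order.TTheory GRing.Theory Num.Theory.
Import numFieldNormedType.Exports.

Set Implicit Arguments.
Unset Strict Implicit.
Unset Printing Implicit Defensive.

Local Open Scope classical_set_scope.
Local Open Scope ring_scope.

Section Euclidean.
Variables (R : realType) (d : nat).
Implicit Types (u v x : 'rV[R]_d) (f : 'rV[R]_d -> R^o).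

Definition dot u v : R := \sum_(i < d) u 0 i * v 0 i.

(* The library norm `|u| on row vectors is the max norm, hence this
   definition; both norms induce the same topology, so that [differentiable]
   and ['D_v f] are the usual notions. *)
Definition enorm u : R := Num.sqrt (dot u u).

Definition gradient f x : 'rV[R]_d := \row_(i < d) 'D_(delta_mx 0 i) f x.

Definition smooth (L : R) f : Prop :=
  forall x y, enorm (gradient f x - gradient f y) <= L * enorm (x - y).

Definition strongly_convex (mu : R) f : Prop :=
  convex_function [set: convex_lmodType 'rV[R]_d]
    (fun x : 'rV[R]_d => f x - mu / 2 * enorm x ^+ 2).

Definition minimizer f x : Prop := forall y, f x <= f y.

Definition usam_point (rho : R) f x : 'rV[R]_d := x + rho *: gradient f x.

Definition polyak_stepsize (rho : R) f (fstar : R) x : R :=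
  let e := usam_point rho f x in
  (f e - fstar - rho * dot (gradient f e) (gradient f x))
    / enorm (gradient f e) ^+ 2.

(* The algorithm stops, i.e. stays put, at a critical point of f. *)
Definition usam_polyak_step (rho : R) f (fstar : R) x : 'rV[R]_d :=
  if gradient f x == 0 then x
  else x - polyak_stepsize rho f fstar x *: gradient f (usam_point rho f x).

Definition usam_polyak (rho : R) f (fstar : R) (x0 : 'rV[R]_d) (t : nat) :
    'rV[R]_d :=
  iter t (usam_polyak_step rho f fstar) x0.

End Euclidean.

(* Main.v *)
Require Import Defs.
From mathcomp Require Import all_boot all_order all_algebra.
From mathcomp Require Import all_classical all_reals all_analysis.
From mathcomp Require Import ring lra.
Import Order.TTheory GRing.Theory Num.Theory.
Import numFieldNormedType.Exports.
Local Open Scope ring_scope.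

(** Write [e = x + rho g] with [g] the gradient at [x], [h] the gradient at [e],
    [N = f e - f* - rho <h, g>] and [F = f x - f*]. Strong convexity at [e] gives
    [<h, x - x*> >= N], so the Polyak step [N / |h|^2] decreases [|x - x*|^2] by
    at least [N^2 / |h|^2] as soon as [N >= 0]. The descent lemma from [e] to [x]
    and [|g|^2 <= 2 L F] give [N >= (1 - (L rho)^2) F], while
    [|h| <= (1 + L rho) |g|]; hence
    [N^2 / |h|^2 >= (1 - L rho)^2 F / (2 L)], and [F >= mu / 2 |x - x*|^2]. *)

(** * Bilinearity of [dot], Cauchy-Schwarz and the triangle inequality for [enorm] *)

Section EuclideanSpace.
Context {R : realType} {d : nat}.
Implicit Types (u v w x y : 'rV[R]_d).

Lemma dotC u v : dot u v = dot v u.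
Proof. by apply: eq_bigr => i _; rewrite mulrC. Qed.

Lemma dotDl u v w : dot (u + v) w = dot u w + dot v w.
Proof. by rewrite -big_split; apply: eq_bigr => i _; rewrite mxE mulrDl. Qed.

Lemma dotZl (a : R) u v : dot (a *: u) v = a * dot u v.
Proof. by rewrite /dot mulr_sumr; apply: eq_bigr => i _; rewrite mxE mulrA. Qed.

Lemma dotNl u v : dot (- u) v = - dot u v.
Proof. by rewrite -scaleN1r dotZl mulN1r. Qed.

Lemma dotDr u v w : dot w (u + v) = dot w u + dot w v.
Proof. by rewrite dotC dotDl !(dotC _ w). Qed.

Lemma dotZr (a : R) u v : dot u (a *: v) = a * dot u v.
Proof. by rewrite dotC dotZl dotC. Qed.

Lemma dotNr u v : dot u (- v) = - dot u v.
Proof. by rewrite dotC dotNl dotC. Qed.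

Lemma dot0l u : dot 0 u = 0.
Proof. by rewrite -(scale0r 0) dotZl mul0r. Qed.

Definition dotE := (dotDl, dotDr, dotNl, dotNr, dotZl, dotZr).

Lemma dot_ge0 u : 0 <= dot u u.
Proof. by apply: sumr_ge0 => i _; rewrite -expr2 sqr_ge0. Qed.

Lemma enorm_ge0 u : 0 <= enorm u.
Proof. exact: sqrtr_ge0. Qed.

Lemma sqr_enorm u : enorm u ^+ 2 = dot u u.
Proof. by rewrite sqr_sqrtr // dot_ge0. Qed.

Lemma enormZ (a : R) u : enorm (a *: u) = `|a| * enorm u.
Proof. by rewrite /enorm !dotE mulrA -expr2 sqrtrM ?sqr_ge0 // sqrtr_sqr. Qed.

Lemma dot_eq0 u : (dot u u == 0) = (u == 0).
Proof.
apply/eqP/eqP => [|->]; last by rewrite dot0l.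
move/eqP; rewrite psumr_eq0 => [/allP u0|i _]; last by rewrite -expr2 sqr_ge0.
apply/rowP => i; rewrite mxE; apply/eqP; have := u0 i (mem_index_enum i).
by rewrite -expr2 sqrf_eq0.
Qed.

Lemma enorm_eq0 u : (enorm u == 0) = (u == 0).
Proof. by rewrite -dot_eq0 -sqr_enorm sqrf_eq0. Qed.

(** Cauchy-Schwarz: the squared norm of [enorm v *: u - enorm u *: v] is [2 * (enorm u * enorm v)]
    times the gap between the two sides. *)
Lemma dot_le_enorm u v : dot u v <= enorm u * enorm v.
Proof.
have [->|u0] := eqVneq u 0; first by rewrite dot0l mulr_ge0 ?enorm_ge0.
have [->|v0] := eqVneq v 0; first by rewrite dotC dot0l mulr_ge0 ?enorm_ge0.
have a0 : 0 < enorm u by rewrite lt_def enorm_eq0 u0 enorm_ge0.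
have b0 : 0 < enorm v by rewrite lt_def enorm_eq0 v0 enorm_ge0.
have := dot_ge0 (enorm v *: u - enorm u *: v).
rewrite !dotE (dotC v u) -!sqr_enorm => H.
have ab0 : 0 < enorm u * enorm v by rewrite mulr_gt0.
rewrite -(ler_pM2l ab0); lra.
Qed.

Lemma enormD u v : enorm (u + v) <= enorm u + enorm v.
Proof.
rewrite -(@ler_pXn2r _ 2) ?nnegrE ?addr_ge0 ?enorm_ge0 //.
rewrite sqr_enorm !dotE (dotC v u) -!sqr_enorm.
have := dot_le_enorm u v; lra.
Qed.

End EuclideanSpace.

(** * First-order bounds from smoothness and strong convexity *)

Section Smooth.
Context {R : realType} {d : nat}.
Variable f : 'rV[R]_d -> R^o.
Hypothesis fdiff : forall x, differentiable f x.
Implicit Types (u v w x y : 'rV[R]_d).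

Lemma derive_dot_gradient x v : 'D_v f x = dot (gradient f x) v.
Proof.
rewrite deriveE // {1}(row_sum_delta v) linear_sum; apply: eq_bigr => i _.
by rewrite linearZ /= mxE deriveE // mulrC.
Qed.

Lemma is_derive_line x v (s : R) :
  is_derive s 1 (fun t : R => f (x + t *: v) : R) (dot (gradient f (x + s *: v)) v).
Proof.
have lin : is_diff (s : R^o) (fun t : R^o => x + t *: v) (fun t : R^o => t *: v).
  rewrite -[X in is_diff _ _ X]add0r.
  exact: (@is_diffD _ R^o _ (cst x) (fun t : R^o => t *: v)).
have dc : differentiable (f \o (fun t : R^o => x + t *: v)) (s : R^o).
  by apply: differentiable_comp.
apply: DeriveDef; first exact: diff_derivable.
rewrite deriveE // diff_comp //= diff_val scale1r -deriveE //.
exact: derive_dot_gradient.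
Qed.

(** The gap [phi] between [f] on the segment and its quadratic model has derivative at most 0, by
    Cauchy-Schwarz and the Lipschitz gradient; the mean value theorem then compares [phi 1] with
    [phi 0]. *)
Lemma descent (L : R) : smooth L f -> forall x v,
  f (x + v) <= f x + dot (gradient f x) v + L / 2 * dot v v.
Proof.
move=> fL x v; set a := dot (gradient f x) v; set b := L / 2 * dot v v.
pose phi (s : R) : R := f (x + s *: v) - (s * a + s ^+ 2 * b).
pose dphi (s : R) := dot (gradient f (x + s *: v)) v - (a + 2 * s * b).
have dphiP (s : R) : is_derive s 1 phi (dphi s).
  apply: is_deriveB; first exact: is_derive_line.
  (* This is the shape produced by the product rule, the zeros being the derivatives of the
     constants [a] and [b]. *)
  have -> : a + 2 * s * b = (s *: 0 + a *: 1) + (s ^+ 2 *: 0 + b *: (2 * s)) :> R.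
    by rewrite !scaler0 !add0r /GRing.scale /= mulr1; ring.
  apply: is_deriveD; apply: is_deriveM.
  by apply: is_derive_eq; rewrite /GRing.scale /=; ring.
have cphi : {within `[0, 1], continuous phi}%classic.
  apply: continuous_subspaceT => s.
  by apply: differentiable_continuous; apply/derivable1_diffP; case: (dphiP s).
have [c] := MVT ltr01 (fun s _ => dphiP s) cphi.
rewrite in_itv /= => /andP[c0 _] phi01.
have dphi_le0 : dphi c <= 0.
  suff : dot (gradient f (x + c *: v) - gradient f x) v <= L * c * dot v v.
    by rewrite !dotE /dphi -/a /b; lra.
  apply: le_trans (dot_le_enorm _ _) _.
  have := fL (x + c *: v) x; rewrite addrAC subrr add0r enormZ gtr0_norm //.
  move=> /(ler_wpM2r (enorm_ge0 v)) /le_trans; apply.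
  by rewrite -sqr_enorm expr2; lra.
move: phi01; rewrite /phi scale1r scale0r addr0 mul0r expr0n mul0r.
by move: dphi_le0; rewrite expr1n !mul1r subr0 mulr1; lra.
Qed.

(* Comparing, for [s > 0], the convexity bound on [f (x + s v)] with a crude
   quadratic lower bound coming from smoothness gives the claim up to O(s). *)
Lemma strongly_convex_lower_bound (L mu : R) :
  smooth L f -> strongly_convex mu f -> forall x v,
  f x + dot (gradient f x) v + mu / 2 * dot v v <= f (x + v).
Proof.
move=> fL fmu x v.
set V := dot v v; set a := dot (gradient f x) v.
(* Descent from [x + s *: v] back to [x] costs [L / 2], and replacing the gradient there by the one
   at [x] costs [L] more, hence [3 / 2]. *)
have low (s : R) : 0 <= s ->
    f x + s * a - 3 / 2 * L * (s ^+ 2 * V) <= f (x + s *: v).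
  move=> s0; have := descent _ fL (x + s *: v) (- (s *: v)).
  rewrite addrK !dotE -/V.
  suff : s * (a - dot (gradient f (x + s *: v)) v) <= L * s ^+ 2 * V by lra.
  have -> : a - dot (gradient f (x + s *: v)) v =
      dot (gradient f x - gradient f (x + s *: v)) v by rewrite !dotE.
  rewrite -mulrA [leRHS]mulrCA expr2 -mulrA ler_wpM2l //.
  apply: le_trans (dot_le_enorm _ _) _.
  have := fL x (x + s *: v).
  rewrite opprD addNKr -scaleNr enormZ normrN ger0_norm //.
  move=> /(ler_wpM2r (enorm_ge0 v)) /le_trans; apply.
  by rewrite /V -sqr_enorm expr2; lra.
have up (s : R) : 0 <= s <= 1 ->
    f (x + s *: v) <= f x + s * (f (x + v) - f x) - mu / 2 * (s * (1 - s)) * V.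
  move=> /andP[s0 s1].
  (* [convex_function] takes its weight as a number bundled with its membership in the unit
     interval. *)
  have s01 : Itv.spec (@Itv.num_sem R) (Itv.Real `[0%Z, 1%Z]) s.
    by rewrite /Itv.num_sem /= !in_itv /= s0 s1 ger0_real.
  have : f (s *: (x + v) + (1 - s) *: x)
        - mu / 2 * enorm (s *: (x + v) + (1 - s) *: x) ^+ 2 <=
      s * (f (x + v) - mu / 2 * enorm (x + v) ^+ 2)
        + (1 - s) * (f x - mu / 2 * enorm x ^+ 2).
    exact: fmu (Itv.mk s01) (x + v) x (in_setT _) (in_setT _).
  have -> : s *: (x + v) + (1 - s) *: x = x + s *: v.
    by rewrite scalerDr scalerBl scale1r addrC -addrA addKr.
  by rewrite !sqr_enorm !dotE (dotC v x) -/V; lra.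
rewrite leNgt; apply/negP => lt0.
set K := (3 / 2 * L + mu / 2) * V.
set e := f x + a + mu / 2 * V - f (x + v).
have e0 : 0 < e by rewrite subr_gt0.
have eK : 0 < e + `|K| by rewrite ltr_wpDr.
set s := e / (e + `|K|).
have s0 : 0 < s by rewrite divr_gt0.
have s1 : s <= 1 by rewrite ler_pdivrMr // mul1r lerDl.
have sE : s * (e + `|K|) = e by rewrite divfK // gt_eqF.
have : s * e <= s * (s * K).
  have := low _ (ltW s0); have := up s; rewrite (ltW s0) s1 => /(_ isT).
  by rewrite /e /K; lra.
rewrite ler_pM2l // => esK.
have : s * K <= s * `|K| by rewrite ler_pM2l // ler_norm.
have : 0 < s * e by rewrite mulr_gt0.
lra.
Qed.

End Smooth.

(** * One step of USAM with the Polyak step size *)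

Section UsamStep.
Context {R : realType} {d : nat}.
Variables (f : 'rV[R]_d -> R^o) (mu L rho : R) (xstar : 'rV[R]_d).
Hypothesis fdiff : forall x, differentiable f x.
Hypotheses (mu_gt0 : 0 < mu) (f_strongly_convex : strongly_convex mu f).
Hypotheses (L_gt0 : 0 < L) (f_smooth : smooth L f).
Hypothesis xstar_min : minimizer f xstar.
Hypotheses (rho_ge0 : 0 <= rho) (Lrho_le1 : L * rho <= 1).
Implicit Types x y : 'rV[R]_d.

(** A gradient step of length [L^-1] lowers [f] by at least the squared gradient norm over [2 * L],
    yet cannot go below the minimum. *)
Lemma sqr_gradient_le x :
  dot (gradient f x) (gradient f x) <= 2 * L * (f x - f xstar).
Proof.
have := descent _ fdiff _ f_smooth x (- L^-1 *: gradient f x).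
have := xstar_min (x + - L^-1 *: gradient f x).
rewrite !dotE; set G := dot _ _; set y := f (_ + _) => h1 h2.
have : (2 * L)^-1 * G <= f x - f xstar.
  suff -> : (2 * L)^-1 * G = L^-1 * G - L / 2 * (L^-1 * (L^-1 * G)) by lra.
  by field; rewrite gt_eqF.
by rewrite mulrC ler_pdivrMr ?mulr_gt0 // mulrC.
Qed.

Lemma gradient_dot_ge x :
  f x - f xstar + mu / 2 * dot (x - xstar) (x - xstar)
    <= dot (gradient f x) (x - xstar).
Proof.
have := strongly_convex_lower_bound _ fdiff _ _ f_smooth f_strongly_convex
  x (- (x - xstar)).
by rewrite opprB subrKC !dotE; lra.
Qed.

(** The bound of [sqr_gradient_le] is zero at [xstar]. *)
Lemma gradient_minimizer : gradient f xstar = 0.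
Proof.
apply/eqP; rewrite -dot_eq0 eq_le dot_ge0 andbT.
by have := sqr_gradient_le xstar; rewrite subrr mulr0.
Qed.

Lemma quadratic_growth x :
  mu / 2 * dot (x - xstar) (x - xstar) <= f x - f xstar.
Proof.
have := strongly_convex_lower_bound _ fdiff _ _ f_smooth f_strongly_convex
  xstar (x - xstar).
by rewrite subrKC gradient_minimizer dot0l; lra.
Qed.

Let polyak_numerator x :=
  f (usam_point rho f x) - f xstar
    - rho * dot (gradient f (usam_point rho f x)) (gradient f x).

Lemma polyak_numerator_ge x :
  (1 - (L * rho) ^+ 2) * (f x - f xstar) <= polyak_numerator x.
Proof.
rewrite /polyak_numerator; set e := usam_point rho f x; set g := gradient f x.
have := descent _ fdiff _ f_smooth e (- (rho *: g)); rewrite {1}/e addrK !dotE.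
have := sqr_gradient_le x; rewrite -/g.
set G := dot g g; set h := dot (gradient f e) g => GF de.
have : L / 2 * rho ^+ 2 * G <= L / 2 * rho ^+ 2 * (2 * L * (f x - f xstar)).
  by rewrite ler_wpM2l // mulr_ge0 ?sqr_ge0 // divr_ge0 // ltW.
rewrite exprMn; lra.
Qed.

(** The term in [rho] of the numerator accounts exactly for the passage from [e - xstar] to
    [x - xstar]. The quadratic term of strong convexity at [e] is dropped; [mu] enters the rate
    through [quadratic_growth]. *)
Lemma polyak_numerator_le x :
  polyak_numerator x <= dot (gradient f (usam_point rho f x)) (x - xstar).
Proof.
rewrite /polyak_numerator; set e := usam_point rho f x.
have := gradient_dot_ge e.
have -> : e - xstar = x - xstar + rho *: gradient f x by rewrite /e addrAC.
rewrite [in leRHS]dotDr dotZr.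
have := dot_ge0 (x - xstar + rho *: gradient f x).
by move/(mulr_ge0 (ltW (divr_gt0 mu_gt0 (ltr0n _ 2)))); lra.
Qed.

Lemma sqr_gradient_usam_point_le x :
  enorm (gradient f (usam_point rho f x)) ^+ 2
    <= (1 + L * rho) ^+ 2 * (2 * L * (f x - f xstar)).
Proof.
set e := usam_point rho f x; set g := gradient f x.
have Lrho0 : 0 <= 1 + L * rho by rewrite addr_ge0 // mulr_ge0 // ltW.
have he : enorm (gradient f e) <= (1 + L * rho) * enorm g.
  have := enormD g (gradient f e - g); rewrite subrKC.
  have := f_smooth e x.
  by rewrite /e /usam_point addrAC subrr add0r enormZ ger0_norm // -/g; lra.
apply: le_trans (_ : ((1 + L * rho) * enorm g) ^+ 2 <= _).
  by rewrite ler_pXn2r // nnegrE ?mulr_ge0 ?enorm_ge0.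
by rewrite exprMn sqr_enorm ler_wpM2l ?sqr_ge0 // sqr_gradient_le.
Qed.

Lemma usam_polyak_step_contracts x :
  enorm (usam_polyak_step rho f (f xstar) x - xstar) ^+ 2 <=
    (1 - mu * (1 - L * rho) ^+ 2 / (4 * L)) * enorm (x - xstar) ^+ 2.
Proof.
set F := f x - f xstar; set D := enorm (x - xstar) ^+ 2.
have F0 : 0 <= F by rewrite subr_ge0.
have growth : mu / 2 * D <= F by rewrite /D sqr_enorm; exact: quadratic_growth.
have D0 : 0 <= D by exact: sqr_ge0.
have LR0 : 0 <= 1 - L * rho by rewrite subr_ge0.
have LR1 : 0 <= L * rho by rewrite mulr_ge0 // ltW.
have rate : mu * (1 - L * rho) ^+ 2 / (4 * L) * D <=
    (1 - L * rho) ^+ 2 * F / (2 * L).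
  have -> : mu * (1 - L * rho) ^+ 2 / (4 * L) * D =
      (1 - L * rho) ^+ 2 / (2 * L) * (mu / 2 * D) by field; rewrite gt_eqF.
  by rewrite [leRHS]mulrAC ler_wpM2l // divr_ge0 ?sqr_ge0 // mulr_ge0 // ltW.
have Nge := polyak_numerator_ge x; have Nle := polyak_numerator_le x.
have hle := sqr_gradient_usam_point_le x; rewrite -/F in Nge hle.
rewrite /usam_polyak_step; case: ifPn => [/eqP g0|_].
  (* At a critical point [gradient_dot_ge] reads [F + mu / 2 * D <= 0], so the iterate that stays
     put is already [xstar]. *)
  have : dot (gradient f x) (x - xstar) = 0.
    by rewrite g0 dot0l.
  have := gradient_dot_ge x; rewrite -sqr_enorm -/D -/F => gF g0'.
  rewrite -/D; have -> : D = 0.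
    apply/eqP; rewrite eq_le D0 andbT -(@ler_pM2l _ (mu / 2)) ?divr_gt0 //; lra.
  by rewrite mulr0.
rewrite /polyak_stepsize; set h := gradient f _ in Nle hle *.
rewrite -/(polyak_numerator x).
set N := polyak_numerator x in Nge Nle *; set H := enorm h ^+ 2 in hle *.
have N0 : 0 <= N.
  by apply: le_trans Nge; rewrite mulr_ge0 // subr_ge0 expr_le1.
have stepE : enorm (x - N / H *: h - xstar) ^+ 2 =
    D - 2 * (N / H) * dot h (x - xstar) + (N / H) ^+ 2 * H.
  rewrite addrAC sqr_enorm !dotE /H /D !sqr_enorm !dotE !(dotC _ h); ring.
rewrite stepE.
suff : (1 - L * rho) ^+ 2 * F / (2 * L) <=
    2 * (N / H) * dot h (x - xstar) - (N / H) ^+ 2 * H by lra.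
(* If [h = 0], the right-hand side vanishes. Then [N <= 0], so [(1 - (L * rho) ^+ 2) * F <= 0], and
   cancelling [1 + L * rho] shows that the left-hand side is at most 0. *)
have [H_eq0|H_neq0] := eqVneq H 0.
  have h0 : h = 0 by apply/eqP; rewrite -enorm_eq0 -sqrf_eq0 -/H H_eq0.
  have dot0 : dot h (x - xstar) = 0 by rewrite h0 dot0l.
  have : (1 - L * rho) * F <= 0.
    rewrite dot0 in Nle; rewrite -(@ler_pM2l _ (1 + L * rho)) ?ltr_wpDr //; lra.
  rewrite H_eq0 dot0 !mulr0 subr0 ler_pdivrMr ?mulr_gt0 // mul0r expr2 -mulrA.
  exact: mulr_ge0_le0.
have H_gt0 : 0 < H by rewrite lt_def H_neq0 sqr_ge0.
apply: (@le_trans _ _ (N ^+ 2 / H)); last first.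
  have -> : (N / H) ^+ 2 * H = N ^+ 2 / H by field.
  have : N / H * N <= N / H * dot h (x - xstar).
    by rewrite ler_wpM2l // divr_ge0 // ltW.
  lra.
rewrite ler_pdivlMr // mulrAC ler_pdivrMr ?mulr_gt0 //.
have Q0 : 0 <= (1 - L * rho) ^+ 2 * F by rewrite mulr_ge0 ?sqr_ge0.
apply: le_trans (ler_wpM2l Q0 hle) _.
(* The factor [(1 + L * rho) ^+ 2] from the bound on [H] completes [(1 - L * rho) ^+ 2] to the
   square of the constant in [polyak_numerator_ge]. *)
have -> : (1 - L * rho) ^+ 2 * F * ((1 + L * rho) ^+ 2 * (2 * L * F)) =
  ((1 - (L * rho) ^+ 2) * F) ^+ 2 * (2 * L) by ring.
rewrite ler_wpM2r //; first by rewrite mulr_ge0 // ltW.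
by rewrite ler_pXn2r // nnegrE mulr_ge0 // subr_ge0 expr_le1.
Qed.

End UsamStep.

(* If [q < 0], which happens in the theorem only when d = 0, then [a] vanishes. *)
Lemma geometric_bound {R : realDomainType} (q : R) (a : nat -> R) :
  (forall t, 0 <= a t) -> (forall t, a t.+1 <= q * a t) ->
  forall t, a t <= q ^+ t * a 0%N.
Proof.
move=> a0 aS; have [q0|q0] := leP 0 q.
  elim=> [|t IH]; first by rewrite mul1r.
  by rewrite exprS -mulrA; apply: le_trans (aS t) _; rewrite ler_wpM2l.
have a_eq0 t : a t = 0.
  apply/eqP; rewrite eq_le a0 andbT -(@nmulr_rge0 _ q) //.
  exact: le_trans (a0 _) (aS t).
by move=> t; rewrite !a_eq0 mulr0.
Qed.

Theorem theorem3p1 (R : realType) (d : nat) (f : 'rV[R]_d -> R^o)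
    (mu L rho : R) (xstar x0 : 'rV[R]_d)
    (fdiff : forall x : 'rV[R]_d, differentiable f x)
    (mu_gt0 : 0 < mu) (f_strongly_convex : strongly_convex mu f)
    (L_gt0 : 0 < L) (f_smooth : smooth L f)
    (xstar_min : minimizer f xstar)
    (rho_bounds : 0 <= rho <= 1 / L) :
  forall t : nat,
    enorm (usam_polyak rho f (f xstar) x0 t - xstar) ^+ 2 <=
      (1 - mu * (1 - L * rho) ^+ 2 / (4 * L)) ^+ t * enorm (x0 - xstar) ^+ 2.
Proof.
move: rho_bounds; rewrite ler_pdivlMr // mulrC => /andP[rho0 Lrho1].
apply: (geometric_bound _
  (fun t => enorm (usam_polyak rho f (f xstar) x0 t - xstar) ^+ 2)).
  by move=> t; exact: sqr_ge0.
by move=> t; exact: usam_polyak_step_contracts.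
Qed.
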